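(* Let $X$ be a finite set of alternatives with $|X| = m \ge 5$ and let $N=\{1,\dots,n\}$ with $n\ge 2$. Let $G: L(X)^N \to 2^X\setminus\{\varnothing\}$ be a social choice correspondence satisfying all of: (1) the Pareto condition; (2) tops-in; (3) balancedness; (4) strong stability. Then $G = G_P$, the Pareto correspondence.
   Context: $X$ is a finite set of alternatives with $|X|=m$, and $N=\{1,\dots,n\}$ is the set of individuals. $L(X)$ is the set of all (strong) orderings on $X$, i.e. complete, asymmetric, transitive relations (strict linear orders; no non-trivial indifference). For an ordering $r$, $r[1]$ denotes its top-ranked element. A profile is an element $u=(u(1),\dots,u(n))$ of $L(X)^N$; write $x\succ_i^u y$ if $x$ ranks above $y$ in $u(i)$. A social choice correspondence is a map $G$ from $L(X)^N$ to the non-empty subsets of $X$. At profile $u$, $x$ Pareto dominates $y$ if $x\succ_i^u y$ for all $i\in N$. The Pareto correspondence is $G_P(u)=\{x\in X: \text{no } y\in X \text{ Pareto dominates } x \text{ at } u\}$. Pareto condition: for all $x,y\in X$ and all profiles $u$, if $x$ Pareto dominates $y$ at $u$ then $y\notin G(u)$. Tops-in: $T(u)\subseteq G(u)$ for all profiles $u$, where $T(u)=\{x\in X: x=u(i)[1] \text{ for some } i\in N\}$. Balancedness: profile $v$ is constructed from profile $u$ by transposition pair $(x,y)$ via individuals $i$ and $j$ if at $u$, $x$ is immediately above $y$ for $i$ and $y$ is immediately above $x$ for $j$, and $v$ is the same as $u$ except that $x$ and $y$ are transposed for $i$ and for $j$. $G$ is balanced if, for all $x,y,u,v,i,j$, whenever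 $v$ is constructed from $u$ by transposition pair $(x,y)$ via individuals $i$ and $j$, then $G(v)=G(u)$. Strong stability: for every pair of profiles $u,u^*$, every pair $x,y$ of alternatives, and every individual $i$, if $x\in G(u)$ and, in ordering $u(i)$, $y$ is adjacent to and just below $x$, and $u^*$ is obtained from $u$ by only lowering $x$ to just below $y$ for $i$, then exactly one of the following holds: (a) $G(u^* )=G(u)$; (b) $G(u^* )=G(u)\setminus\{x\}$ where $x\in G(u)$; (c) $G(u^* )=G(u)\cup\{y\}$ where $y\notin G(u)$. *)

(* Defs.v *)
From HB Require Import structures.
From mathcomp Require Import all_boot all_fingroup.

Set Implicit Arguments.
Unset Strict Implicit.
Unset Printing Implicit Defensive.

(* Relations are encoded extensionally, as sets of pairs, so that two orderings
   ranking all alternatives in the same way are equal. *)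
Definition is_ordering (X : finType) (r : {set X * X}) : bool :=
  [&& [forall x, forall y, (x != y) ==> ((x, y) \in r) || ((y, x) \in r)],
      [forall x, forall y, ((x, y) \in r) ==> ((y, x) \notin r)] &
      [forall x, forall y, forall z,
        ((x, y) \in r) && ((y, z) \in r) ==> ((x, z) \in r)]].

Record ordering (X : finType) : Type :=
  Ordering { order_pairs : {set X * X}; _ : is_ordering order_pairs }.

HB.instance Definition _ (X : finType) := [isSub for @order_pairs X].
HB.instance Definition _ (X : finType) := [Finite of ordering X by <:].

Definition above (X : finType) (r : ordering X) : rel X :=
  fun x y => (x, y) \in order_pairs r.

Coercion above : ordering >-> rel.

Definition profile (n : nat) (X : finType) : Type := {ffun 'I_n -> ordering X}.

Section Concepts.

Variables (n : nat) (X : finType).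

Implicit Types (r s : ordering X) (u v : profile n X) (x y : X) (i j : 'I_n).
Implicit Type G : profile n X -> {set X}.

Definition pareto_dominates u x y : bool := [forall i, u i x y].

Definition pareto_correspondence u : {set X} :=
  [set x | ~~ [exists y, pareto_dominates u y x]].

Definition pareto_condition G : Prop :=
  forall x y u, pareto_dominates u x y -> y \notin G u.

Definition is_top r x : bool := [forall y, (y != x) ==> r x y].

Definition tops u : {set X} := [set x | [exists i, is_top (u i) x]].

Definition tops_in G : Prop := forall u, tops u \subset G u.

Definition immediately_above r x y : Prop :=
  r x y /\ ~ exists z, r x z /\ r z y.

Definition transposed x y r s : Prop :=
  forall a b, s a b = r (tperm x y a) (tperm x y b).

Definition transposition_pair u v x y i j : Prop :=
  [/\ immediately_above (u i) x y,
      immediately_above (u j) y x,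
      transposed x y (u i) (v i),
      transposed x y (u j) (v j) &
      forall k, k != i -> k != j -> v k = u k].

Definition balanced G : Prop :=
  forall x y u v i j, transposition_pair u v x y i j -> G v = G u.

Definition lowered_just_below x y r s : Prop :=
  immediately_above s y x /\
  forall a b, a != x -> b != x -> s a b = r a b.

Definition exactly_one_of (A B C : Prop) : Prop :=
  [\/ [/\ A, ~ B & ~ C], [/\ ~ A, B & ~ C] | [/\ ~ A, ~ B & C]].

Definition strongly_stable G : Prop :=
  forall u v x y i,
    x \in G u ->
    immediately_above (u i) x y ->
    lowered_just_below x y (u i) (v i) ->
    (forall k, k != i -> v k = u k) ->
    exactly_one_of
      (G v = G u)
      (x \in G u /\ G v = G u :\ x)
      (y \notin G u /\ G v = y |: G u).

End Concepts.

(* Main.v *)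
Require Import Defs.
From mathcomp Require Import all_boot all_fingroup.

(** Fix an individual [i]. Every Pareto optimal [x] is shown to be chosen, by
    induction on the number of alternatives that [i] ranks above [x]; when there
    is none, [x] is a top and tops-in applies. Otherwise let [a] be just above
    [x] for [i], and suppose that [x] is Pareto optimal but not chosen.

    The engine is that strong stability protects third alternatives: if [a] and
    [b] are exchanged in one ordering, and the upper one of the two is chosen
    before the exchange, then the status of any [z] other than [a] and [b] does
    not change ([stable_third]). By the induction hypothesis the Pareto optimal
    alternatives above [x] for [i] are chosen, so they may be moved in the other
    orderings without letting [x] in, as long as they do not cross [x].

    This is used twice. If [a] is dominated, its dominator [p] ranked highest by
    [i] is Pareto optimal, and some [j] ranks [x] above [p], hence also above
    [a]; sinking [p] below [a] for [j] removes [p] from the dominators of [a]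
    ([sink_dominator]). Repetition makes [a] Pareto optimal ([make_optimal]).
    Then some [j] ranks [x] above [a], and [a] is raised for [j] until it is just
    below [x] ([raise_to_just_below]). Now [a] and [x] are adjacent for [i] and
    for [j], in opposite directions, so balancedness allows exchanging them for
    both. This lifts [x] for [i] while [x] stays Pareto optimal and not chosen,
    which contradicts the induction hypothesis. *)

Set Implicit Arguments.
Unset Strict Implicit.
Unset Printing Implicit Defensive.

(** * Orderings and adjacent transpositions *)

Section Orderings.

Variable X : finType.
Implicit Types (r s : ordering X) (x y z a b : X).

Lemma ordering_total r x y : x != y -> r x y || r y x.
Proof.
have [/forallP/(_ x)/forallP/(_ y)/implyP tot _ _] := and3P (valP r).
exact: tot.
Qed.

Lemma ordering_asym r x y : r x y -> r y x = false.
Proof.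
have [_ /forallP/(_ x)/forallP/(_ y)/implyP asym _] := and3P (valP r).
by move=> /asym/negbTE.
Qed.

Lemma ordering_trans r y x z : r x y -> r y z -> r x z.
Proof.
have [_ _ /forallP/(_ x)/forallP/(_ y)/forallP/(_ z)/implyP tr] := and3P (valP r).
by move=> xy yz; apply: tr; apply/andP.
Qed.

Lemma ordering_irr r x : r x x = false.
Proof. by apply/negP => rxx; have := ordering_asym rxx; rewrite rxx. Qed.

Lemma ordering_neq r x y : r x y -> x != y.
Proof. by apply: contraTneq => ->; rewrite ordering_irr. Qed.

Lemma ordering_negE r x y : x != y -> ~~ r x y -> r y x.
Proof. by move=> /(ordering_total r) /orP[->|]. Qed.

Definition upper r x : {set X} := [set z | r z x].
Definition lower r x : {set X} := [set z | r x z].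

Lemma card_upper_lt r x y : r x y -> #|upper r x| < #|upper r y|.
Proof.
move=> rxy; apply/proper_card/properP; split.
  by apply/subsetP => z; rewrite !inE => /ordering_trans; apply.
by exists x; rewrite inE // ordering_irr.
Qed.

Lemma immediately_below_exists r x y :
  r x y -> exists z, immediately_above r x z.
Proof.
move=> rxy.
case: (@arg_minnP _ y (r x) (fun z => #|upper r z|) rxy) => z rxz min_z.
exists z; split=> // -[w [rxw rwz]].
by move: (min_z w rxw); rewrite /= leqNgt card_upper_lt.
Qed.

Lemma immediately_above_exists r x y :
  r x y -> exists z, immediately_above r z y.
Proof.
move=> rxy.
case: (@arg_maxnP _ x (r^~ y) (fun z => #|upper r z|) rxy) => z rzy max_z.
exists z; split=> // -[w [rzw rwy]].
by move: (max_z w rwy); rewrite /= leqNgt card_upper_lt.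
Qed.

Lemma immediately_above_lower r x y z :
  immediately_above r x y -> z != y -> r x z = r y z.
Proof.
move=> [rxy nbtw] zy; apply/idP/idP=> [rxz|]; last exact: ordering_trans.
apply: ordering_negE => //; apply/negP => rzy.
by apply: nbtw; exists z.
Qed.

Lemma immediately_above_upper r x y z :
  immediately_above r x y -> z != x -> r z y = r z x.
Proof.
move=> [rxy nbtw] zx; apply/idP/idP=> [rzy|rzx].
  apply: ordering_negE; first by rewrite eq_sym.
  by apply/negP => rxz; apply: nbtw; exists z.
exact: ordering_trans rzx rxy.
Qed.

Lemma transpose_is_ordering r x y :
  is_ordering [set p | r (tperm x y p.1) (tperm x y p.2)].
Proof.
apply/and3P; split; apply/forallP => a; apply/forallP => b.
- apply/implyP => ab; rewrite !inE /=; apply: ordering_total.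
  by rewrite (inj_eq perm_inj).
- by apply/implyP; rewrite !inE /= => /ordering_asym ->.
- apply/forallP => c; apply/implyP; rewrite !inE /= => /andP[].
  exact: ordering_trans.
Qed.

Definition transpose x y r : ordering X :=
  Ordering (transpose_is_ordering r x y).

Lemma transposeE x y r a b : transpose x y r a b = r (tperm x y a) (tperm x y b).
Proof. by rewrite /above inE. Qed.

Lemma transposeK x y : involutive (transpose x y).
Proof.
move=> r; apply: val_inj; apply/setP => -[a b].
by rewrite -[LHS]/(transpose x y _ a b) !transposeE !tpermK.
Qed.

Lemma transposeC x y r : transpose x y r = transpose y x r.
Proof.
apply: val_inj; apply/setP => -[a b].
by rewrite -[LHS]/(transpose x y _ a b) transposeE tpermC -transposeE.
Qed.

(** Adjacency makes the transposition invisible to every other pair: whatever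
    is compared with [x] compares in the same way with [y]. *)
Lemma transpose_other r x y a b : immediately_above r x y ->
  (a, b) != (x, y) -> (a, b) != (y, x) -> transpose x y r a b = r a b.
Proof.
move=> xy; rewrite transposeE !xpair_eqE.
case: tpermP => [->|->|/eqP ax /eqP ay]; case: tpermP => [->|->|/eqP bx /eqP b_y];
  rewrite ?eqxx ?ordering_irr //= => _ _.
- by rewrite (immediately_above_lower xy).
- by rewrite (immediately_above_lower xy).
- by rewrite (immediately_above_upper xy).
- by rewrite (immediately_above_upper xy).
Qed.

Lemma transpose_reversed r x y :
  immediately_above r x y -> immediately_above (transpose x y r) y x.
Proof.
move=> [rxy nbtw]; split; first by rewrite transposeE tpermL tpermR.
move=> [z]; rewrite !transposeE tpermL tpermR => -[xz zy].
by apply: nbtw; exists (tperm x y z).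
Qed.

Lemma transpose_lowered r x y :
  immediately_above r x y -> lowered_just_below x y r (transpose x y r).
Proof.
move=> xy; split=> [|a b ax bx]; first exact: transpose_reversed.
by rewrite transpose_other // xpair_eqE negb_and ?ax ?bx ?orbT.
Qed.

Lemma transpose_upper_proper r x y : immediately_above r x y ->
  #|upper (transpose x y r) y| < #|upper r y|.
Proof.
move=> xy; apply/proper_card/properP; split; last first.
  exists x; first by rewrite inE xy.1.
  by rewrite inE (ordering_asym (transpose_reversed xy).1).
apply/subsetP => z; rewrite !inE transposeE tpermR => rzx.
move: rzx; case: tpermP => [->|->|_ _] rzx.
- exact: xy.1.
- by rewrite ordering_irr in rzx.
- exact: ordering_trans rzx xy.1.
Qed.

Lemma transpose_lower_proper r x y : immediately_above r x y ->
  #|lower (transpose x y r) x| < #|lower r x|.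
Proof.
move=> xy; apply/proper_card/properP; split; last first.
  exists y; first by rewrite inE xy.1.
  by rewrite inE (ordering_asym (transpose_reversed xy).1).
apply/subsetP => z; rewrite !inE transposeE tpermL => ryz.
move: ryz; case: tpermP => [->|->|_ _] ryz.
- by rewrite ordering_irr in ryz.
- exact: xy.1.
- exact: ordering_trans xy.1 ryz.
Qed.

End Orderings.

(** * Profiles *)

Section Profiles.

Variables (X : finType) (n : nat).
Implicit Types (u v : profile n X) (x y z a b : X) (i j k : 'I_n).

Definition swap u i x y : profile n X :=
  [ffun k => if k == i then transpose x y (u k) else u k].

Lemma swap_at u i x y : swap u i x y i = transpose x y (u i).
Proof. by rewrite ffunE eqxx. Qed.

Lemma swap_off u i x y k : k != i -> swap u i x y k = u k.
Proof. by rewrite ffunE => /negbTE ->. Qed.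

Lemma swapK u i x y : swap (swap u i x y) i x y = u.
Proof.
by apply/ffunP => k; rewrite !ffunE; case: eqP => // _; rewrite transposeK.
Qed.

Lemma swapC u i x y : swap u i x y = swap u i y x.
Proof. by apply/ffunP => k; rewrite !ffunE transposeC. Qed.

Lemma swap_other u i x y k a b : immediately_above (u i) x y ->
  (a, b) != (x, y) -> (a, b) != (y, x) -> swap u i x y k a b = u k a b.
Proof.
by rewrite ffunE; case: (eqVneq k i) => [->|]; first exact: transpose_other.
Qed.

Definition dominators u x : {set X} := [set z | pareto_dominates u z x].

Lemma optimalE u x : (x \in pareto_correspondence u) = (dominators u x == set0).
Proof.
rewrite inE; apply/idP/eqP => [nex|D0].
  apply/setP => z; rewrite !inE; apply/negbTE; apply: contra nex => zx.
  by apply/existsP; exists z.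
apply/existsP => -[z zx]; have: z \in dominators u x by rewrite inE.
by rewrite D0 inE.
Qed.

Lemma dominates_trans u y x z :
  pareto_dominates u x y -> pareto_dominates u y z -> pareto_dominates u x z.
Proof.
move=> /forallP xy /forallP yz; apply/forallP => k.
exact: ordering_trans (xy k) (yz k).
Qed.

Lemma optimal_witness u x y : x \in pareto_correspondence u -> y != x ->
  exists j, u j x y.
Proof.
rewrite optimalE => /eqP D0 yx.
have: y \notin dominators u x by rewrite D0 inE.
rewrite inE => /forallPn[j nyx]; exists j; exact: ordering_negE nyx.
Qed.

Lemma swap_dominators_other u i x y b : immediately_above (u i) x y ->
  b != x -> b != y -> dominators (swap u i x y) b = dominators u b.
Proof.
move=> xy bx b_y; apply/setP => z; rewrite !inE; apply: eq_forallb => k.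
by rewrite swap_other // xpair_eqE negb_and ?bx ?b_y orbT.
Qed.

Lemma swap_dominators_raised u i x y : immediately_above (u i) x y ->
  dominators (swap u i x y) y = dominators u y :\ x.
Proof.
move=> xy; apply/setP => z; rewrite !inE; case: (eqVneq z x) => [->|zx] /=.
  apply/forallP => /(_ i); rewrite swap_at.
  by rewrite (ordering_asym (transpose_reversed xy).1).
apply: eq_forallb => k; rewrite swap_other //.
  by rewrite xpair_eqE (negbTE zx).
by rewrite xpair_eqE (eq_sym y) (negbTE (ordering_neq xy.1)) andbF.
Qed.

End Profiles.

(** * Lifting an unchosen Pareto optimal alternative *)

Section Lifting.

Variables (X : finType) (n : nat) (G : profile n X -> {set X}).
Hypothesis G_balanced : balanced G.
Hypothesis G_stable : strongly_stable G.
Implicit Types (u v : profile n X) (y z b p q : X) (j k : 'I_n).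

Lemma stable_third u j p q z : immediately_above (u j) p q -> p \in G u ->
  z != p -> z != q -> (z \in G (swap u j p q)) = (z \in G u).
Proof.
move=> pq pG zp zq.
have := @G_stable u (swap u j p q) p q j pG pq.
rewrite swap_at => /(_ (transpose_lowered pq)) /(_ (@swap_off _ _ u j p q)).
by case=> [[-> _ _] | [_ [_ ->] _] | [_ _ [_ ->]]]; rewrite ?inE ?zp ?(negbTE zq).
Qed.

Variables (i : 'I_n) (r : ordering X) (x a : X).
Hypothesis ax : immediately_above r a x.
(** The induction hypothesis. It is stated for all profiles with the same
    ordering [r] of [i], since the other orderings are going to be modified. *)
Hypothesis optimal_above_chosen : forall v y,
  v i = r -> r y x -> y \in pareto_correspondence v -> y \in G v.

Definition counterexample v : Prop :=
  [/\ v i = r, x \in pareto_correspondence v & x \notin G v].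

(** If [x] is above some alternative for [j] and below it in [r], then [j] is
    not [i]; so exchanging alternatives other than [x] for [j] keeps everything
    but possibly the status of [x]. *)
Lemma swap_counterexample u j p q b : counterexample u -> u j x b -> r b x ->
  immediately_above (u j) p q -> x != p -> x != q ->
  (x \in G (swap u j p q)) = (x \in G u) -> counterexample (swap u j p q).
Proof.
move=> [ui xP xG] xb bx pq xp xq eqG; split; last by rewrite eqG.
  rewrite swap_off //; apply: contraTneq xb => <-.
  by rewrite ui (ordering_asym bx).
by rewrite optimalE swap_dominators_other // -optimalE.
Qed.

(** The dominator [p] of [a] that is highest in [r] is undominated, since its
    own dominators would also dominate [a]. This persists while [p] sinks for
    [j] towards [a], because the dominators of [a] and the ordering of [i] stay
    the same. *)
Lemma sink_dominator u j p : counterexample u -> p \in dominators u a ->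
  (forall q, q \in dominators u a -> ~~ r q p) -> u j x p ->
  exists2 v, counterexample v & dominators v a = dominators u a :\ p.
Proof.
have [m] := ubnP #|lower (u j) p|; elim: m u => // m IHm u lt_m ce pD highest xp.
have [ui xP xG] := ce.
have pa : pareto_dominates u p a by rewrite inE in pD.
have rpx : r p x.
  by apply: (ordering_trans _ ax.1); rewrite -ui; apply: (forallP pa).
have pG : p \in G u.
  apply: optimal_above_chosen => //; rewrite optimalE; apply/eqP/setP => q.
  rewrite !inE; apply/negP => qp.
  have /highest/negP[] : q \in dominators u a by rewrite inE (dominates_trans qp).
  by rewrite -ui; apply: (forallP qp).
have [q pq] := immediately_below_exists (forallP pa j).
have xnp : x != p by apply: ordering_neq xp.
have xnq : x != q by apply: ordering_neq (ordering_trans xp pq.1).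
have ce' : counterexample (swap u j p q).
  apply: (swap_counterexample ce xp rpx pq xnp xnq); exact: stable_third.
have [eqa|aq] := eqVneq a q.
  by exists (swap u j p q) => //; rewrite eqa swap_dominators_raised.
have D' : dominators (swap u j p q) a = dominators u a.
  rewrite swap_dominators_other // eq_sym.
  exact: ordering_neq (forallP pa j).
rewrite -D'; apply: IHm => //; rewrite ?D' //.
  by rewrite swap_at; apply: leq_trans (transpose_lower_proper pq) _.
by rewrite swap_other // xpair_eqE ?(negbTE xnp) ?(negbTE xnq).
Qed.

Lemma make_optimal u : counterexample u ->
  exists2 v, counterexample v & a \in pareto_correspondence v.
Proof.
have [m] := ubnP #|dominators u a|; elim: m u => // m IHm u lt_m ce.
have [D0|[p0 p0D]] := set_0Vmem (dominators u a).
  by exists u; rewrite ?optimalE ?D0.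
case: (@arg_minnP _ p0 (mem (dominators u a)) (fun q => #|upper r q|) p0D).
move=> p /= pD min_p.
have [ui xP _] := ce.
have rpx : r p x.
  apply: (ordering_trans _ ax.1); rewrite -ui.
  by move: pD; rewrite inE => /forallP.
have [j xp] := optimal_witness xP (ordering_neq rpx).
have highest q : q \in dominators u a -> ~~ r q p.
  by move=> /min_p; rewrite leqNgt; apply: contra; apply: card_upper_lt.
have [v ce_v Dv] := sink_dominator ce pD highest xp.
apply: IHm ce_v; rewrite Dv.
by rewrite (cardsD1 p) pD in lt_m.
Qed.

(** Raising [a] keeps it Pareto optimal, hence chosen after each exchange. It is
    the upper one of the two then, so stability is applied backwards. *)
Lemma raise_to_just_below u j : counterexample u ->
  a \in pareto_correspondence u -> u j x a ->
  exists2 v, counterexample v & immediately_above (v j) x a.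
Proof.
have [m] := ubnP #|upper (u j) a|; elim: m u => // m IHm u lt_m ce aP xa.
have [c ca] := immediately_above_exists xa.
have [xc|xc] := eqVneq x c; first by exists u; rewrite ?xc.
have xna : x != a by apply: ordering_neq xa.
have ui : u i = r by case: ce.
have ij : i != j.
  by apply: contraTneq xa => <-; rewrite ui (ordering_asym ax.1).
have aP' : a \in pareto_correspondence (swap u j c a).
  rewrite optimalE swap_dominators_raised //; move: aP; rewrite optimalE.
  by move=> /eqP ->; rewrite set0D.
have aG' : a \in G (swap u j c a).
  by apply: optimal_above_chosen; rewrite ?swap_off //; apply: ax.1.
have eqG : (x \in G (swap u j c a)) = (x \in G u).
  rewrite -[in RHS](swapK u j c a) [in RHS]swapC; symmetry.
  apply: stable_third => //; rewrite swap_at; exact: transpose_reversed.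
apply: (IHm (swap u j c a)) => //.
- by rewrite swap_at; apply: leq_trans (transpose_upper_proper ca) _.
- by apply: swap_counterexample ce xa ax.1 ca xc xna eqG.
- by rewrite swap_other // xpair_eqE ?(negbTE xc) ?(negbTE xna).
Qed.

(** The exchange for [i] adds no dominator of [x] and the one for [j] adds only
    the candidate [a], which [i] now ranks below [x]; so [x] stays Pareto
    optimal, while balancedness keeps the choice set. *)
Lemma lift_counterexample u : counterexample u ->
  exists v, [/\ #|upper (v i) x| < #|upper r x|,
                x \in pareto_correspondence v & x \notin G v].
Proof.
move=> /make_optimal[u1 ce1 aP1].
have anx : a != x by apply: ordering_neq ax.1.
have [j xa1] : exists j, u1 j x a.
  by case: ce1 => _ xP1 _; apply: optimal_witness.
have [u2 ce2 xa] := raise_to_just_below ce1 aP1 xa1.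
have [ui xP xG] := ce2.
have ax2 : immediately_above (u2 i) a x by rewrite ui.
have ji : j != i.
  by apply: contraTneq xa.1 => ->; rewrite ui (ordering_asym ax.1).
pose u3 := swap u2 i a x.
have xa3 : immediately_above (u3 j) x a by rewrite swap_off.
exists (swap u3 j x a); split.
- rewrite swap_off 1?eq_sym // swap_at ui; exact: transpose_upper_proper.
- rewrite optimalE; apply/eqP/setP => z; rewrite !inE; apply/negP => zx.
  have [eza|za] := eqVneq z a.
    move/forallP/(_ i): zx; rewrite swap_off 1?eq_sym // swap_at eza.
    by rewrite (ordering_asym (transpose_reversed ax2).1).
  move: xP; rewrite optimalE => /eqP/setP/(_ z); rewrite !inE => /negP[].
  apply/forallP => k; have := forallP zx k.
  have xz : z != x by apply: ordering_neq (forallP zx k).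
  by rewrite !swap_other // xpair_eqE ?(negbTE za) ?(negbTE xz).
- suff -> : G (swap u3 j x a) = G u2 by [].
  apply: (G_balanced (x := a) (y := x) (i := i) (j := j)); split=> //.
  + by move=> b c; rewrite swap_off 1?eq_sym // swap_at transposeE.
  + by move=> b c; rewrite swap_at swap_off // transposeE tpermC.
  + by move=> k ki kj; rewrite !swap_off.
Qed.

End Lifting.

Theorem theorem4 (X : finType) (n : nat) (G : profile n X -> {set X})
    (card_X : 5 <= #|X|) (n_ge2 : 2 <= n)
    (G_nonempty : forall u : profile n X, G u != set0)
    (G_pareto : pareto_condition G)
    (G_tops_in : tops_in G)
    (G_balanced : balanced G)
    (G_stable : strongly_stable G) :
  forall u : profile n X, G u = pareto_correspondence u.
Proof.
have i : 'I_n by apply: Ordinal n_ge2.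
suff optimal_chosen m (u : profile n X) x : #|upper (u i) x| < m ->
    x \in pareto_correspondence u -> x \in G u.
  move=> u; apply/eqP; rewrite eqEsubset; apply/andP; split; apply/subsetP => x.
    move=> xG; rewrite inE; apply/existsP => -[y /G_pareto].
    by rewrite xG.
  exact: optimal_chosen (ltnSn _).
elim: m u x => // m IHm u x lt_m xP; apply/negPn/negP => xG.
have [U0|[y]] := set_0Vmem (upper (u i) x).
  move/negP: xG; apply; apply: (subsetP (G_tops_in u)).
  rewrite inE; apply/existsP; exists i; apply/forallP => y; apply/implyP => yx.
  apply: ordering_negE yx _.
  by have: y \notin upper (u i) x; [rewrite U0 inE | rewrite inE].
rewrite inE => /immediately_above_exists[a ax].
have above_chosen (v : profile n X) y' : v i = u i -> u i y' x ->
    y' \in pareto_correspondence v -> y' \in G v.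
  move=> vi y'x; apply: IHm; rewrite vi.
  exact: leq_trans (card_upper_lt y'x) _.
have [v [lt_v xPv /negP[]]] :=
  lift_counterexample G_balanced G_stable ax above_chosen (And3 erefl xP xG).
by apply: IHm => //; apply: leq_trans lt_v _.
Qed.
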